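(* Let $\ell \geq 1$ and $n$ be integers with $n \ge \ell+1$. Then $\Delta_{\ell+1}^{\ell} \,|\, \Delta_n^{\ell}$ if and only if $n+1 \in \mathcal{D}(\ell+2,\ell+1) \setminus \mathcal{X}(\ell+2,\ell+1)$.
   Context: $\Delta_n$ denotes the $n$-dimensional simplex (whose 1-skeleton is $K_{n+1}$); its $j$-faces correspond to the $(j+1)$-element subsets of its $n+1$ vertices. For a polytope $A$, $A^k$ denotes its $k$-skeleton. For polytopal $\ell$-complexes $L,K$, $L\,|\,K$ means $K$ and $L$ both have dimension $\ell$ and $K$ is a union of subcomplexes $L_1,\dots,L_r$, each isomorphic to $L$, such that every $\ell$-face of $K$ lies in exactly one $L_i$. A $(v,k,t)$-configuration is a $v$-element set together with a family of $k$-element subsets (blocks) such that every $t$-element subset lies in exactly one block. For $1\le t < k$, the divisibility set is $\mathcal{D}(k,t) = \{ v \ge k : \binom{k-h}{t-h} \text{ divides } \binom{v-h}{t-h} \text{ for all } 0 \le h \le t-1\}$, and $\mathcal{X}(k,t)$ denotes the set of $v \in \mathcal{D}(k,t)$ for which no $(v,k,t)$-configuration exists; by Keevash's theorem on the existence of designs, $\mathcal{X}(k,t)$ is finite, and a $(v,k,t)$-configuration exists iff $v \in \mathcal{D}(k,t)\setminus\mathcal{X}(k,t)$. The theorem is stated assuming Keevash's result. *)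

(* Defs.v *)
From mathcomp Require Import all_boot all_order all_algebra.
From mathcomp Require Import all_classical reals.

Set Implicit Arguments.
Unset Strict Implicit.
Unset Printing Implicit Defensive.

Import Order.TTheory GRing.Theory Num.Theory.

Local Open Scope classical_set_scope.
Local Open Scope ring_scope.

Section Polytopes.
Variables (R : realType) (d : nat).
Implicit Types (P F G : set 'rV[R]_d) (K : set (set 'rV[R]_d)).

Definition conv_hull (m : nat) (p : 'I_m -> 'rV[R]_d) : set 'rV[R]_d :=
  [set x | exists w : 'I_m -> R,
    [/\ forall i, 0 <= w i, \sum_i w i = 1 & x = \sum_i w i *: p i]].

Definition polytope P : Prop :=
  exists (m : nat) (p : 'I_m -> 'rV[R]_d), P = conv_hull p.

(* The inequality a.x <= b is valid on P and F is where it is tight. With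
   a = 0 this makes P itself (b = 0) and the empty set (b = 1) faces of P. *)
Definition face P F : Prop :=
  exists (a : 'rV[R]_d) (b : R),
    (forall x, P x -> \sum_j a 0 j * x 0 j <= b) /\
    F = [set x | P x /\ \sum_j a 0 j * x 0 j = b].

Definition affinely_independent (m : nat) (p : 'I_m -> 'rV[R]_d) : Prop :=
  forall c : 'I_m -> R,
    \sum_i c i = 0 -> \sum_i c i *: p i = 0 -> forall i, c i = 0.

(* The dimension of P (that of its affine hull) is one less than the maximal
   number of affinely independent points of P; the empty set, of dimension -1,
   satisfies [dim_le _ k] for every k and [has_dim _ k] for none. *)
Definition dim_le P (k : nat) : Prop :=
  forall (m : nat) (p : 'I_m -> 'rV[R]_d),
    (forall i, P (p i)) -> affinely_independent p -> (m <= k.+1)%N.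

Definition has_dim P (k : nat) : Prop :=
  dim_le P k /\
  exists p : 'I_k.+1 -> 'rV[R]_d,
    (forall i, P (p i)) /\ affinely_independent p.

Definition polytopal_complex K : Prop :=
  [/\ finite_set K,
      forall P, K P -> polytope P,
      forall P F, K P -> face P F -> K F &
      forall P G, K P -> K G -> face P (P `&` G) /\ face G (P `&` G)].

Definition complex_dim K (k : nat) : Prop :=
  (forall P, K P -> dim_le P k) /\ exists P, K P /\ has_dim P k.

Definition subcomplex (L K : set (set 'rV[R]_d)) : Prop :=
  polytopal_complex L /\ L `<=` K.

Definition skeleton P (k : nat) : set (set 'rV[R]_d) :=
  [set F | face P F /\ dim_le F k].

End Polytopes.

Definition complex_iso (R : realType) (d e : nat)
    (L : set (set 'rV[R]_d)) (K : set (set 'rV[R]_e)) : Prop :=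
  exists f : set 'rV[R]_d -> set 'rV[R]_e,
    set_bij L K f /\
    forall F G, L F -> L G -> (f F `<=` f G <-> F `<=` G).

(* L | K for polytopal l-complexes L and K. *)
Definition complex_divides (R : realType) (l d e : nat)
    (L : set (set 'rV[R]_d)) (K : set (set 'rV[R]_e)) : Prop :=
  [/\ polytopal_complex L /\ complex_dim L l,
      polytopal_complex K /\ complex_dim K l &
      exists (r : nat) (Ls : 'I_r -> set (set 'rV[R]_e)),
        [/\ forall i, subcomplex (Ls i) K,
            forall i, complex_iso (Ls i) L,
            K = \bigcup_i Ls i &
            forall F, K F -> has_dim F l -> exists! i, Ls i F]].

(* The standard n-simplex, with vertices the n + 1 unit vectors of R^(n+1). *)
Definition simplex (R : realType) (n : nat) : set 'rV[R]_n.+1 :=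
  conv_hull (fun i : 'I_n.+1 => delta_mx 0 i).

Arguments simplex R n : clear implicits.

Definition configuration (V : finType) (k t : nat) (B : {set {set V}}) : Prop :=
  (forall b, b \in B -> #|b| = k) /\
  (forall T : {set V}, #|T| = t -> exists! b, b \in B /\ T \subset b).

Definition configuration_exists (v k t : nat) : Prop :=
  exists (V : finType) (B : {set {set V}}), #|V| = v /\ configuration k t B.

Definition divisibility_set (k t : nat) : set nat :=
  [set v | (k <= v)%N /\
    forall h, (h < t)%N -> ('C(k - h, t - h) %| 'C(v - h, t - h))%N].

Definition exceptional_set (k t : nat) : set nat :=
  [set v | divisibility_set k t v /\ ~ configuration_exists v k t].

(* Main.v *)
(* Faces of a simplex are the sets of points supported on a given vertex set S,
   so the l-skeleton of the n-simplex is the poset of vertex sets of size at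
   most l + 1, and its subcomplexes are the down-closed subfamilies. A
   down-closed family isomorphic to the boundary of the (l + 1)-simplex is
   determined by its atoms, hence consists of all proper subsets of an
   (l + 2)-set. A decomposition of the skeleton is therefore the same thing as
   an (n + 1, l + 2, l + 1)-configuration, and the divisibility conditions are
   automatic for configurations by double counting. *)
Require Import Defs.
From mathcomp Require Import all_boot all_order all_algebra.
From mathcomp Require Import all_classical reals.
From mathcomp Require Import fintype finset.

Set Implicit Arguments.
Unset Strict Implicit.
Unset Printing Implicit Defensive.

Import Order.TTheory GRing.Theory Num.Theory.

(** * Finite sets of prescribed size and the divisibility conditions *)

Lemma subset_of_card (V : finType) (A : {set V}) (h : nat) :
  h <= #|A| -> exists2 H : {set V}, H \subset A & #|H| = h.
Proof.
elim: h => [|h IHh] hA; first by exists set0; rewrite ?sub0set ?cards0.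
have [H sHA cH] := IHh (ltnW hA).
have /set0Pn[x] : A :\: H != set0.
  by rewrite setD_eq0; apply: contraL hA => /subset_leq_card; rewrite cH -leqNgt.
rewrite in_setD => /andP[xH xA]; exists (x |: H).
  by rewrite subUset sub1set xA.
by rewrite cardsU1 xH cH.
Qed.

Lemma superset_of_card (V : finType) (S : {set V}) (t : nat) :
  #|S| <= t <= #|V| -> exists2 T : {set V}, S \subset T & #|T| = t.
Proof.
move=> /andP[St tV].
have [|H sH cH] := @subset_of_card _ (~: S) (t - #|S|).
  by rewrite [#|~: S|]cardsCs setCK leq_sub2r.
exists (S :|: H); first exact: subsetUl.
rewrite cardsU (_ : S :&: H = set0) ?cards0 ?subn0 ?cH ?subnKC //.
by apply/eqP; rewrite setI_eq0 disjoint_sym disjoints_subset.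
Qed.

(** Removing [H] maps these sets [T] bijectively onto the subsets of [A :\: H] of size [t - #|H|];
    the inverse adds [H] back. *)
Lemma card_interval (V : finType) (H A : {set V}) (t : nat) :
  H \subset A -> #|H| <= t ->
  #|[set T : {set V} | [&& H \subset T, T \subset A & #|T| == t]]|
    = 'C(#|A| - #|H|, t - #|H|).
Proof.
move=> sHA Ht; rewrite -(cardsDS sHA) -cards_draws.
rewrite -(card_in_imset (f := fun T => T :\: H)); last first.
  move=> T T'; rewrite !inE => /and3P[HT _ _] /and3P[HT' _ _] eqD.
  by rewrite -(setID T H) -(setID T' H) eqD (setIidPr HT) (setIidPr HT').
apply: eq_card => D; rewrite inE; apply/imsetP/andP => [[T]|[sDA /eqP cD]].
  rewrite inE => /and3P[HT TA /eqP cT] ->; split; first exact: setSD.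
  by rewrite cardsDS // cT.
have dDH : [disjoint D & H] by move: sDA; rewrite subsetD => /andP[].
have DH0 : H :&: D = set0 by apply/eqP; rewrite setIC setI_eq0.
exists (H :|: D).
  rewrite inE subsetUl subUset sHA (subset_trans sDA) ?subsetDl //=.
  by rewrite cardsU DH0 cards0 subn0 cD subnKC.
by rewrite setDUl setDv set0U; apply/esym/setDidPl.
Qed.

(* Double counting of the pairs (T, b) with H \subset T \subset b, #|T| = t,
   for a fixed h-set H. *)
Lemma configuration_divides (V : finType) (k t h : nat) (B : {set {set V}}) :
  configuration k t B -> h <= t -> t <= #|V| ->
  'C(k - h, t - h) %| 'C(#|V| - h, t - h).
Proof.
move=> [cB uB] ht tV.
have [|H _ cH] := @subset_of_card V setT h; first by rewrite cardsT (leq_trans ht).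
pose I (A : {set V}) :=
  [set T : {set V} | [&& H \subset T, T \subset A & #|T| == t]].
have cI (A : {set V}) : H \subset A -> #|I A| = 'C(#|A| - h, t - h).
  by move=> sHA; rewrite card_interval ?cH.
rewrite -cardsT -cI ?subsetT //.
(* The inner sum is 1 because exactly one block contains [T]. *)
have -> : #|I setT| = \sum_(T in I setT) \sum_(b in B | T \subset b) 1.
  rewrite -sum1_card; apply: eq_bigr => T; rewrite inE => /and3P[_ _ /eqP cT].
  have [b [[bB Tb] ub]] := uB T cT.
  rewrite (big_pred1 b) // => c; apply/andP/eqP => [[cC Tc]|->] //.
  by rewrite (ub c).
rewrite (exchange_big_dep (mem B)) /=; last by move=> T b _ /andP[].
apply: dvdn_sum => b bB.
(* A block that misses part of [H] contributes 0; any other contributes [#|I b|], which is the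
   divisor itself. *)
have [sHb|nHb] := boolP (H \subset b); last first.
  rewrite big_pred0 // => T; rewrite inE bB subsetT /=; apply: contraNF nHb.
  by case/andP=> /andP[HT _]; apply: subset_trans.
rewrite sum1_card -(cB b bB) -(cI b sHb); rewrite -(eq_card (A := I b)) // => T.
by rewrite [RHS]unfold_in /= !inE bB subsetT /= -andbA [(_ == _) && _]andbC.
Qed.

(** * Down-closed families isomorphic to the boundary of a simplex *)

(** The order isomorphism [f] matches singletons with singletons, which gives an injection [phi]
    from [U] to [V]. Every member [T] of [A] is then the [phi]-image of [f T], so [b] is the image
    of [phi]. *)
Lemma boundary_iso (U V : finType) (A : {set {set V}})
    (f : {set V} -> {set U}) :
  1 < #|U| ->
  (forall S T : {set V}, T \in A -> S \subset T -> S \in A) ->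
  (forall T, T \in A -> f T \proper setT) ->
  (forall S : {set U}, S \proper setT -> exists2 T, T \in A & f T = S) ->
  (forall T T' : {set V}, T \in A -> T' \in A -> (f T \subset f T') = (T \subset T')) ->
  exists2 b : {set V}, #|b| = #|U| & forall T : {set V}, (T \in A) = (T \proper b).
Proof.
move=> cU dA fA sf monof.
have injf (T T' : {set V}) : T \in A -> T' \in A -> f T = f T' -> T = T'.
  by move=> TA TA' e; apply/eqP; rewrite eqEsubset -!monof // e subxx.
have A0 : set0 \in A.
  have [|T TA _] := sf set0; last exact: dA TA (sub0set _).
  by rewrite properT eq_sym -card_gt0 cardsT ltnW.
have f0 : f set0 = set0.
  have [|T TA fT] := sf set0.
    by rewrite properT eq_sym -card_gt0 cardsT ltnW.
  by apply/eqP; rewrite -subset0 -fT monof // sub0set.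
(* As [1 < #|U|], the set [[set a]] is proper and has a preimage [T]. For any [x] in [T],
   down-closure puts [[set x]] in [A], and [f [set x]] is a nonempty subset of [[set a]]. *)
have atom a : exists x : V, [set x] \in A /\ f [set x] = [set a].
  have [|T TA fT] := sf [set a].
    by rewrite properEcard subsetT cards1 cardsT.
  have [T0|/set0Pn[x xT]] := eqVneq T set0.
    by move/setP/(_ a): fT; rewrite T0 f0 !inE eqxx.
  have xA : [set x] \in A by apply: dA TA _; rewrite sub1set.
  exists x; split=> //.
  have : f [set x] \subset [set a] by rewrite -fT monof // sub1set.
  rewrite subset1 => /orP[/eqP//|/eqP fx0].
  by move/setP/(_ x): (injf _ _ xA A0 (etrans fx0 (esym f0))); rewrite !inE eqxx.
have [phi phiP] := choice atom.
have phi_inj : injective phi.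
  move=> a a' e; apply/set1P; rewrite -(proj2 (phiP a')) -e (proj2 (phiP a)).
  exact: set11.
have memf (T : {set V}) a : T \in A -> (phi a \in T) = (a \in f T).
  move=> TA; have [pA fa] := phiP a.
  by rewrite -sub1set -(monof _ _ pA TA) fa sub1set.
have imf (T : {set V}) : T \in A -> T = phi @: f T.
  move=> TA; apply/setP=> x; apply/idP/imsetP => [xT|[a aT ->]]; last first.
    by rewrite memf.
  have xA : [set x] \in A by apply: dA TA _; rewrite sub1set.
  have [fx0|/set0Pn[a ax]] := eqVneq (f [set x]) set0.
    by move/setP/(_ x): (injf _ _ xA A0 (etrans fx0 (esym f0))); rewrite !inE eqxx.
  exists a; last by apply/esym/set1P; rewrite memf.
  by apply: subsetP ax; rewrite monof // sub1set.
exists (phi @: setT); first by rewrite card_imset // cardsT.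
move=> T; apply/idP/idP => [TA|Tb].
  rewrite (imf T TA) properEcard imsetS ?subsetT // !card_imset // .
  by have := fA T TA; rewrite properEcard => /andP[].
(* The preimage of [T] under [phi] is a proper subset of [U], hence [f T'] for some [T'] in [A];
   [imf] then identifies [T'] with [T]. *)
have TE : T = phi @: (phi @^-1: T).
  apply/setP=> x; apply/idP/imsetP => [xT|[a]]; last by rewrite inE => ? ->.
  have /imsetP[a _ xa] := subsetP (proper_sub Tb) x xT.
  by exists a; rewrite // inE -xa.
have [|T' TA' fT'] := sf (phi @^-1: T).
  rewrite properT; apply: contraTneq Tb => e.
  by rewrite TE e properxx.
by rewrite TE -fT' -imf.
Qed.

(** * Faces of the standard simplex as vertex sets *)

Section SimplexFaces.
Local Open Scope ring_scope.
Variables (R : realType) (n : nat).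
Implicit Types (S T : {set 'I_n.+1}) (x : 'rV[R]_n.+1).

(** Points are given by barycentric coordinates. For [S] empty the sum condition fails, so the empty
    face is included. *)
Definition simplex_face S : set 'rV[R]_n.+1 :=
  [set x | [/\ forall i, 0 <= x 0 i, \sum_i x 0 i = 1
             & forall i, i \notin S -> x 0 i = 0]]%classic.

Definition vertices (F : set 'rV[R]_n.+1) : {set 'I_n.+1} :=
  [set i | `[< F (delta_mx 0 i) >]].

Lemma vertex_simplex_face S i : simplex_face S (delta_mx 0 i) <-> i \in S.
Proof.
split=> [[_ _ dS]|iS].
  apply: contraT => /dS; rewrite mxE !eqxx => /eqP.
  by rewrite oner_eq0.
split=> [j||j]; first by rewrite mxE; case: eqP.
  rewrite (bigD1 i) //= big1 ?addr0 ?mxE ?eqxx // => j ji.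
  by rewrite mxE (negbTE ji) andbF.
by move=> jS; rewrite mxE eqxx /=; case: eqP => // ji; rewrite ji iS in jS.
Qed.

Lemma simplex_faceK : cancel simplex_face vertices.
Proof.
by move=> S; apply/setP=> i; rewrite inE; apply/asboolP/idP => /vertex_simplex_face.
Qed.

Lemma simplex_faceS S T :
  (simplex_face S `<=` simplex_face T)%classic <-> S \subset T.
Proof.
split=> [sST|/subsetP sST x [x0 x1 xS]].
  apply/subsetP=> i /vertex_simplex_face iS.
  exact/vertex_simplex_face/sST.
by split=> // i iT; apply: xS; apply: contra iT => /sST.
Qed.

Lemma simplex_faceI S T :
  (simplex_face S `&` simplex_face T)%classic = simplex_face (S :&: T).
Proof.
apply/seteqP; split=> x.
  move=> [[x0 x1 xS] [_ _ xT]]; split=> // i.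
  by rewrite in_setI negb_and => /orP[/xS|/xT].
by case=> x0 x1 xST; split; split=> // i iS; apply: xST;
   rewrite in_setI (negbTE iS) ?andbF.
Qed.

(** The enumeration [g] is arbitrary so as to serve both the whole simplex, with [g] the identity,
    and its faces, with [g] the map [enum_val]. *)
Lemma conv_hull_vertices m (g : 'I_m -> 'I_n.+1) S :
  injective g -> (forall i, i \in S <-> exists j, i = g j) ->
  conv_hull (fun j => delta_mx 0 (g j)) = simplex_face S.
Proof.
move=> g_inj gS.
have SE : S = g @: setT.
  apply/setP=> i; apply/idP/imsetP => [/gS[j ->]|[j _ ->]]; first by exists j.
  by apply/gS; exists j.
apply/seteqP; split=> x.
  case=> w [w0 w1 ->].
  have xE i : (\sum_j w j *: delta_mx 0 (g j) : 'rV[R]_n.+1) 0 i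
      = \sum_j (if i == g j then w j else 0).
    rewrite summxE; apply: eq_bigr => j _.
    by rewrite !mxE eqxx /=; case: eqP => _; rewrite ?mulr1 ?mulr0.
  split=> [i||i iS].
  - by rewrite xE; apply: sumr_ge0 => j _; case: eqP.
  - under eq_bigr do rewrite xE.
    rewrite exchange_big /= -[RHS]w1; apply: eq_bigr => j _.
    by rewrite -big_mkcond /= big_pred1_eq.
  - rewrite xE big1 // => j _; case: eqP => // ij; case/negP: iS.
    by apply/gS; exists j.
case=> x0 x1 xS; exists (fun j => x 0 (g j)); split=> //.
  rewrite -x1 (bigID (mem S)) /= [X in _ = _ + X]big1 // addr0 SE.
  by rewrite big_imset /=; [apply: eq_bigl => j; rewrite inE | move=> ? ? _ _ /g_inj].
rewrite [LHS]row_sum_delta (bigID (mem S)) /= [X in _ + X]big1 ?addr0; last first.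
  by move=> i /xS ->; rewrite scale0r.
by rewrite SE big_imset /=; [apply: eq_bigl => j; rewrite inE | move=> ? ? _ _ /g_inj].
Qed.

Lemma simplexE : simplex R n = simplex_face setT.
Proof.
by apply: conv_hull_vertices => // i; rewrite inE; split=> // _; exists i.
Qed.

Lemma simplex_face_polytope S : polytope (simplex_face S).
Proof.
exists #|S|, (fun j => delta_mx 0 (enum_val j)); apply/esym.
apply: conv_hull_vertices => [|i]; first exact: enum_val_inj.
split=> [iS|[j ->]]; last exact: enum_valP.
by exists (enum_rank_in iS i); rewrite enum_rankK_in.
Qed.

(** On the simplex, [b] minus the functional is the sum of the terms [(b - a 0 j) * x 0 j], all
    nonnegative. It vanishes exactly when [x] is supported on the vertices where [a] equals [b]. *)
Lemma face_simplex_face S (F : set 'rV[R]_n.+1) :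
  face (simplex_face S) F <-> exists2 T : {set 'I_n.+1}, T \subset S & F = simplex_face T.
Proof.
split=> [[a [b [ab ->]]]|[T TS ->]].
  have aS i : i \in S -> a 0 i <= b.
    move=> /vertex_simplex_face/ab; rewrite (bigD1 i) //= big1 ?addr0.
      by rewrite mxE !eqxx mulr1.
    by move=> j ji; rewrite mxE (negbTE ji) andbF mulr0.
  have dE x : simplex_face S x ->
      b - \sum_j a 0 j * x 0 j = \sum_j (b - a 0 j) * x 0 j.
    case=> _ x1 _; under [RHS]eq_bigr do rewrite mulrBl.
    by rewrite sumrB -mulr_sumr x1 mulr1.
  exists [set i in S | a 0 i == b].
    by apply/subsetP=> i; rewrite inE => /andP[].
  apply/seteqP; split=> x.
    move=> [xF axb]; have [x0 x1 xS] := xF; split=> // i.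
    rewrite inE; have [iS /= aib|/xS //] := boolP (i \in S).
    have := dE x xF; rewrite axb subrr => /esym s0.
    have d0 j : true -> 0 <= (b - a 0 j) * x 0 j.
      move=> _; have [jS|/xS ->] := boolP (j \in S); last by rewrite mulr0.
      by rewrite mulr_ge0 // subr_ge0 aS.
    move: (psumr_eq0P d0 s0 (i := i) isT) => /eqP.
    by rewrite mulf_eq0 subr_eq0 eq_sym (negbTE aib) => /eqP.
  move=> [x0 x1 xT].
  have xF : simplex_face S x.
    by split=> // i iS; apply: xT; rewrite inE (negbTE iS).
  split=> //; apply/eqP; rewrite eq_sym -subr_eq0 dE //; apply/eqP/big1 => i _.
  have [aib|aib] := eqVneq (a 0 i) b; first by rewrite aib subrr mul0r.
  by rewrite xT ?mulr0 // inE (negbTE aib) andbF.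
(* Conversely, take the indicator of [T] with bound 1: the slack is the total weight of [x] outside
   [T]. *)
pose a : 'rV[R]_n.+1 := \row_i (i \in T)%:R.
have aE x : simplex_face S x ->
    1 - \sum_j a 0 j * x 0 j = \sum_(j | j \notin T) x 0 j.
  case=> _ x1 _; rewrite -x1 -sumrB [RHS]big_mkcond; apply: eq_bigr => j _.
  by rewrite mxE; case: (j \in T); rewrite /= ?mul1r ?mul0r ?subrr ?subr0.
exists a, 1; split=> [x xF|].
  by rewrite -subr_ge0 aE //; apply: sumr_ge0 => j _; case: xF.
apply/seteqP; split=> x.
  move=> xT; have xF : simplex_face S x by exact: (simplex_faceS T S).2 TS x xT.
  split=> //; apply/eqP; rewrite eq_sym -subr_eq0 aE //; apply/eqP/big1 => i.
  by case: xT => _ _ /[apply].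
move=> [xF /eqP]; rewrite eq_sym -subr_eq0 aE // => /eqP s0.
have [x0 x1 _] := xF; split=> // i iT.
by apply: (psumr_eq0P _ s0).
Qed.

(* On the hyperplane where the coordinates sum to 1, affine independence is
   linear independence. *)
Lemma affinely_independent_card S m (p : 'I_m -> 'rV[R]_n.+1) :
  (forall i, simplex_face S (p i)) -> affinely_independent p -> (m <= #|S|)%N.
Proof.
(* [Q] keeps only the coordinates in [S], the others being 0, so its rank is at most [#|S|]. *)
move=> pS ip; pose Q : 'M[R]_(m, #|S|) := \matrix_(i, j) p i 0 (enum_val j).
suff /eqP <- : row_free Q by exact: rank_leq_col.
apply: inj_row_free => v vQ0.
have v0 k : \sum_i v 0 i * p i 0 k = 0.
  have [kS|kS] := boolP (k \in S); last first.
    by rewrite big1 // => i _; case: (pS i) => _ _ ->; rewrite ?mulr0.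
  have := congr1 (fun M : 'rV_#|S| => M 0 (enum_rank_in kS k)) vQ0.
  rewrite !mxE => sv; rewrite -[RHS]sv; apply: eq_bigr => i _.
  by rewrite mxE enum_rankK_in.
(* The coefficients sum to 0: each point has coordinate sum 1, so their sum is the coordinate sum of
   the vanishing combination. *)
apply/rowP=> i; rewrite mxE; apply: (ip (fun i => v 0 i)).
  transitivity (\sum_k \sum_i v 0 i * p i 0 k); last by rewrite big1.
  rewrite exchange_big; apply: eq_bigr => j _ /=.
  by rewrite -mulr_sumr; case: (pS j) => _ -> _; rewrite mulr1.
apply/rowP=> k; rewrite summxE mxE -[RHS](v0 k).
by apply: eq_bigr => j _; rewrite mxE.
Qed.

Lemma vertices_independent S :
  affinely_independent (fun j : 'I_#|S| => delta_mx 0 (enum_val j) : 'rV[R]_n.+1).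
Proof.
move=> c _ c0 j.
have := congr1 (fun M : 'rV_n.+1 => M 0 (enum_val j)) c0.
rewrite summxE mxE (bigD1 j) //= big1 ?addr0; first by rewrite !mxE !eqxx mulr1.
move=> i ij; rewrite !mxE (inj_eq enum_val_inj) eq_sym.
by rewrite (negbTE ij) andbF mulr0.
Qed.

Lemma dim_le_simplex_face S k : dim_le (simplex_face S) k <-> (#|S| <= k.+1)%N.
Proof.
split=> [dS|Sk m p pS ip]; last exact: leq_trans (affinely_independent_card pS ip) Sk.
apply: dS (vertices_independent (S := S)) => j.
exact/vertex_simplex_face/enum_valP.
Qed.

Lemma has_dim_simplex_face S k : has_dim (simplex_face S) k <-> #|S| = k.+1.
Proof.
split=> [[/dim_le_simplex_face Sk [p [pS ip]]]|Sk].
  by apply/eqP; rewrite eqn_leq Sk (affinely_independent_card pS ip).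
split; first by apply/dim_le_simplex_face; rewrite Sk.
rewrite -Sk; exists (fun j : 'I_#|S| => delta_mx 0 (enum_val j)); split.
  by move=> j; apply/vertex_simplex_face/enum_valP.
exact: vertices_independent.
Qed.

(** Skeleta and their subcomplexes all have this form, which reduces questions on polytopes to
    finite set families. *)
Definition face_family (A : {set {set 'I_n.+1}}) : set (set 'rV[R]_n.+1) :=
  [set F | exists2 S : {set 'I_n.+1}, S \in A & F = simplex_face S]%classic.

Lemma in_face_family A S : face_family A (simplex_face S) <-> S \in A.
Proof.
split=> [[T TA /(can_inj simplex_faceK) -> //]|SA]; by exists S.
Qed.

Lemma skeleton_simplex k :
  skeleton (simplex R n) k = face_family [set S : {set 'I_n.+1} | (#|S| <= k.+1)%N].
Proof.
rewrite simplexE; apply/seteqP; split=> F.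
  case=> /face_simplex_face[S _ ->] /dim_le_simplex_face Sk.
  by exists S; rewrite ?inE.
case=> S; rewrite inE => Sk ->; split; last exact/dim_le_simplex_face.
by apply/face_simplex_face; exists S; rewrite ?subsetT.
Qed.

(** Down-closure is closure under faces, and two faces meet in the face on their common vertices. *)
Lemma face_family_complex (A : {set {set 'I_n.+1}}) :
  (forall S T : {set 'I_n.+1}, T \in A -> S \subset T -> S \in A) ->
  polytopal_complex (face_family A).
Proof.
move=> dA; split.
- apply: (@sub_finite_set _ _ (simplex_face @` [set` A])%classic).
    by move=> F [S SA ->]; exists S.
  exact/finite_image/finite_finset.
- by move=> _ [S _ ->]; exact: simplex_face_polytope.
- move=> _ F [S SA ->] /face_simplex_face[T TS ->].
  by apply/in_face_family; apply: dA SA TS.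
- move=> _ _ [S SA ->] [T TA ->]; rewrite simplex_faceI.
  by split; apply/face_simplex_face; exists (S :&: T); rewrite ?subsetIl ?subsetIr.
Qed.

Lemma subcomplex_face_family (A : {set {set 'I_n.+1}}) (L : set (set 'rV[R]_n.+1)) :
  subcomplex L (face_family A) ->
  exists2 A' : {set {set 'I_n.+1}}, L = face_family A' &
    forall S T : {set 'I_n.+1}, T \in A' -> S \subset T -> S \in A'.
Proof.
move=> [[_ _ fL _] LA].
exists [set S : {set 'I_n.+1} | `[< L (simplex_face S) >]].
  apply/seteqP; split=> F.
    move=> LF; have [S _ FS] := LA F LF; exists S => //.
    by rewrite inE; apply/asboolP; rewrite -FS.
  by case=> S; rewrite inE => /asboolP LS ->.
move=> S T; rewrite !inE => /asboolP LT ST; apply/asboolP.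
by apply: fL LT _; apply/face_simplex_face; exists S.
Qed.

End SimplexFaces.

Arguments simplex_face R {n} S.
Arguments face_family R {n} A.

(** * Relabelling the points of a configuration *)

Lemma configuration_imset (V W : finType) (h : V -> W) (h' : W -> V)
    (k t : nat) (B : {set {set V}}) :
  cancel h h' -> cancel h' h -> configuration k t B ->
  configuration k t [set h @: (b : {set V}) | b in B].
Proof.
move=> hK hK' [cB uB]; split=> [_ /imsetP[b bB ->]|T cT].
  by rewrite card_imset ?cB //; exact: can_inj hK.
have imK (b : {set V}) : h' @: (h @: b) = b.
  by rewrite -imset_comp (eq_imset _ hK) imset_id.
have imK' (c : {set W}) : h @: (h' @: c) = c.
  by rewrite -imset_comp (eq_imset _ hK') imset_id.
have [|b [[bB Tb] ub]] := uB (h' @: T).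
  by rewrite card_imset //; exact: can_inj hK'.
exists (h @: b); split; first by split; [exact: imset_f | rewrite -(imK' T) imsetS].
move=> _ [/imsetP[c cB' ->] Tc]; rewrite (ub c) //.
by split=> //; rewrite -(imK c) imsetS.
Qed.

Lemma configuration_existsP (v k t : nat) :
  configuration_exists v k t <-> exists B : {set {set 'I_v}}, configuration k t B.
Proof.
split=> [[V [B [<- cB]]]|[B cB]]; last by exists 'I_v, B; rewrite card_ord.
by eexists; apply: configuration_imset (@enum_rankK V) (@enum_valK V) cB.
Qed.

(** * Isomorphisms with the boundary of the simplex, in terms of vertex sets *)

Section BoundaryIso.
Variables (R : realType) (n m : nat).

(** Numbering the elements of [b] by [g], image and preimage under [g] are mutually inverse between
    subsets of ['I_m.+1] and subsets of [b]. *)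
Lemma boundary_family_iso (b : {set 'I_n.+1}) : #|b| = m.+1 ->
  complex_iso (face_family R [set S : {set 'I_n.+1} | S \proper b])
              (face_family R [set S : {set 'I_m.+1} | S \proper setT]).
Proof.
move=> cb; pose g (j : 'I_m.+1) : 'I_n.+1 := enum_val (cast_ord (esym cb) j).
have g_inj : injective g by move=> i j /enum_val_inj/cast_ord_inj.
have gb : g @: setT = b.
  apply/eqP; rewrite eqEcard card_imset // cardsT card_ord cb leqnn andbT.
  by apply/subsetP=> _ /imsetP[j _ ->]; exact: enum_valP.
have preK (S : {set 'I_n.+1}) : S \subset b -> g @: (g @^-1: S) = S.
  rewrite -gb => /subsetP sSb; apply/setP=> i; apply/imsetP/idP.
    by case=> j; rewrite inE => ? ->.
  by move=> iS; have /imsetP[j _ ij] := sSb i iS; exists j; rewrite // inE -ij.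
have imK (S : {set 'I_m.+1}) : g @^-1: (g @: S) = S.
  by apply/setP=> i; rewrite inE mem_imset.
exists (fun F => simplex_face R (g @^-1: vertices F)); split; first split.
- move=> _ [S Sb ->]; rewrite simplex_faceK; apply/in_face_family.
  rewrite inE in Sb; rewrite inE properT; apply: contraTneq Sb => e.
  apply/negP => Sb; have := preK S (proper_sub Sb).
  by rewrite e gb => e'; rewrite -e' properxx in Sb.
- move=> _ _ /set_mem[S Sb ->] /set_mem[T Tb ->].
  rewrite !simplex_faceK => /(can_inj (@simplex_faceK R m)) e.
  rewrite inE in Sb; rewrite inE in Tb.
  by rewrite -(preK S) ?e ?preK // proper_sub.
- move=> _ [S SP ->]; exists (simplex_face R (g @: S)).
    apply/in_face_family; rewrite inE -gb properEcard imsetS ?subsetT //.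
    by move: SP; rewrite inE !card_imset // properEcard => /andP[].
  by rewrite simplex_faceK imK.
- move=> _ _ [S Sb ->] [T Tb ->]; rewrite !simplex_faceK !simplex_faceS.
  rewrite inE in Sb; rewrite inE in Tb.
  split=> [sST|]; last exact: preimsetS.
  by move: (imsetS g sST); rewrite (preK S (proper_sub Sb)) (preK T (proper_sub Tb)).
Qed.

(** Reading the isomorphism on vertex sets gives the map [phi], to which [boundary_iso] applies;
    [0 < m] provides at least two vertices. *)
Lemma iso_boundary_family (A : {set {set 'I_n.+1}}) : 0 < m ->
  (forall S T : {set 'I_n.+1}, T \in A -> S \subset T -> S \in A) ->
  complex_iso (face_family R A)
              (face_family R [set S : {set 'I_m.+1} | S \proper setT]) ->
  exists2 b : {set 'I_n.+1}, #|b| = m.+1 &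
    forall T : {set 'I_n.+1}, (T \in A) = (T \proper b).
Proof.
move=> m0 dA [f [[fun_f inj_f surj_f] mon_f]].
pose phi (T : {set 'I_n.+1}) := vertices (f (simplex_face R T)).
have fE (T : {set 'I_n.+1}) : T \in A ->
    phi T \proper setT /\ f (simplex_face R T) = simplex_face R (phi T).
  move=> TA; have [|S SP fS] := fun_f (simplex_face R T).
    exact/in_face_family.
  by rewrite /phi fS simplex_faceK; split=> //; rewrite inE in SP.
rewrite -[m.+1]card_ord; apply: (@boundary_iso _ _ A phi) => //.
- by rewrite card_ord.
- by move=> T /fE[].
- move=> S SP; have [|_ [T TA ->] fT] := surj_f (simplex_face R S).
    by apply/in_face_family; rewrite inE.
  by exists T; rewrite // /phi fT simplex_faceK.
- move=> T T' TA TA'; have := mon_f (simplex_face R T) (simplex_face R T').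
  rewrite (fE T TA).2 (fE T' TA').2 !simplex_faceS => mon.
  by apply/idP/idP=> ?; apply/mon => //; exact/in_face_family.
Qed.

End BoundaryIso.

(** * Decompositions of the skeleton and configurations *)

Lemma skeleton_boundary (R : realType) (l : nat) :
  skeleton (simplex R l.+1) l
    = face_family R [set S : {set 'I_l.+2} | S \proper setT].
Proof.
rewrite skeleton_simplex; congr face_family; apply/setP=> S.
by rewrite !inE properEcard subsetT cardsT card_ord.
Qed.

Lemma skeleton_simplex_complex (R : realType) (l n : nat) : l <= n ->
  polytopal_complex (skeleton (simplex R n) l) /\
  complex_dim (skeleton (simplex R n) l) l.
Proof.
move=> ln; rewrite skeleton_simplex; split.
  apply: face_family_complex => S T; rewrite !inE => Tl /subset_leq_card ST.
  exact: leq_trans Tl.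
split=> [_ [S + ->]|]; first by rewrite inE => ?; apply/dim_le_simplex_face.
(* The dimension [l] is attained because there are at least [l.+1] vertices. *)
have [|S _ cS] := @subset_of_card _ [set: 'I_n.+1] l.+1.
  by rewrite cardsT card_ord.
exists (simplex_face R S); split; last exact/has_dim_simplex_face.
by apply/in_face_family; rewrite inE cS.
Qed.

Lemma proper_of_card (V : finType) (k : nat) (T b : {set V}) :
  #|T| = k -> #|b| = k.+1 -> (T \proper b) = (T \subset b).
Proof. by move=> cT cb; rewrite properEcard cT cb ltnSn andbT. Qed.

Lemma divides_simplex_configuration (R : realType) (l n : nat) :
  l < n ->
  complex_divides l (skeleton (simplex R l.+1) l) (skeleton (simplex R n) l)
  <-> configuration_exists n.+1 l.+2 l.+1.
Proof.
move=> ln; rewrite configuration_existsP.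
have sn := skeleton_simplex_complex R (ltnW ln).
split=> [[_ _ [r [Ls [subL isoL _ uL]]]]|[B [cB uB]]].
  have bP i : exists b : {set 'I_n.+1}, #|b| = l.+2 /\
      forall T : {set 'I_n.+1}, Ls i (simplex_face R T) <-> T \proper b.
    move: (subL i) (isoL i); rewrite skeleton_simplex skeleton_boundary.
    move=> /subcomplex_face_family[A -> dA] /(iso_boundary_family (ltn0Sn l) dA).
    by move=> [b cb bA]; exists b; split=> // T; rewrite -bA in_face_family.
  have [b bE] := choice bP.
  exists [set b i | i : 'I_r]; split=> [_ /imsetP[i _ ->]|T cT].
    by case: (bE i).
  have inL i : Ls i (simplex_face R T) <-> T \subset b i.
    by rewrite (bE i).2 (proper_of_card cT (bE i).1).
  have [||i [Li ui]] := uL (simplex_face R T).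
  - by rewrite skeleton_simplex; apply/in_face_family; rewrite inE cT.
  - exact/has_dim_simplex_face.
  exists (b i); split; first by split; [exact: imset_f | exact/inL].
  (* Another block containing [T] is some [b j] with the face of [T] in [Ls j], so [j] equals
     [i]. *)
  by move=> _ [/imsetP[j _ ->] /inL/ui ->].
split=> //; first exact: skeleton_simplex_complex.
(* One copy per block: the proper subsets of that block. *)
pose A (i : 'I_#|B|) := [set S : {set 'I_n.+1} | S \proper enum_val i].
have bB (i : 'I_#|B|) : #|enum_val i| = l.+2 by apply/cB/enum_valP.
exists #|B|, (fun i => face_family R (A i)); rewrite skeleton_simplex.
have sA i : (face_family R (A i) `<=`
    face_family R [set S : {set 'I_n.+1} | #|S| <= l.+1])%classic.
  move=> _ [S + ->]; rewrite inE properEcard bB => /andP[_ ?].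
  by apply/in_face_family; rewrite inE.
split=> [i|i||].
- split; last exact: sA.
  apply: face_family_complex => S T; rewrite !inE => Tb ST.
  exact: sub_proper_trans Tb.
- by rewrite skeleton_boundary; exact: boundary_family_iso.
- apply/seteqP; split=> [_ [S + ->]|F [i _ Fi]]; last exact: sA Fi.
  (* Faces of lower dimension are covered by enlarging [S] to [l.+1] vertices and taking the block
     through the result. *)
  rewrite inE => Sl; have [|T ST cT] := @superset_of_card _ S l.+1.
    by rewrite Sl card_ord ltnW.
  have [b [[bB' Tb] _]] := uB T cT.
  exists (enum_rank_in bB' b) => //; apply/in_face_family.
  rewrite inE enum_rankK_in //; apply: sub_proper_trans ST _.
  by rewrite (proper_of_card cT) // cB.
- move=> _ [T _ ->] /has_dim_simplex_face cT.
  have inA i : face_family R (A i) (simplex_face R T) <-> T \subset enum_val i.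
    by rewrite in_face_family inE (proper_of_card cT (bB i)).
  have [b [[bB' Tb] ub]] := uB T cT.
  exists (enum_rank_in bB' b); split=> [|i /inA Ti].
    by apply/inA; rewrite enum_rankK_in.
  (* Distinct indices enumerate distinct blocks, so uniqueness of the block gives uniqueness of the
     index. *)
  apply: enum_val_inj; rewrite enum_rankK_in //; apply: ub; split=> //.
  exact: enum_valP.
Qed.

Local Open Scope classical_set_scope.

Theorem theorem2 (R : realType) (l n : nat) (hl : (1 <= l)%N) (hn : (l + 1 <= n)%N) :
  complex_divides l (skeleton (simplex R (l + 1)) l) (skeleton (simplex R n) l)
  <-> (n + 1)%N \in
      divisibility_set (l + 2) (l + 1) `\` exceptional_set (l + 2) (l + 1).
Proof.
move: hn; rewrite !addn1 addn2 => hn.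
rewrite divides_simplex_configuration // in_setE; split=> [conf|[div nexc]].
  split; last by case.
  split=> [|h hl']; first by rewrite ltnS.
  have [B cB] := (configuration_existsP _ _ _).1 conf.
  have := configuration_divides cB (ltnW hl').
  by rewrite card_ord; apply; rewrite ltnW.
(* Being in the divisibility set but not exceptional only refutes nonexistence; classical logic
   yields the configuration. *)
by apply: contrapT => nconf; apply: nexc.
Qed.
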